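(* Let $\mathcal{X}$ be a real topological vector space with continuous dual space $\mathcal{X}^{\ast}$, and let $\Psi \colon \mathcal{X}^{\ast} \to [0,+\infty]$ be positively homogeneous of degree one. For $x \in \mathcal{X}$ and $A \subseteq \mathcal{X}$ let $$d_{\perp,\Psi}(x,A) := \sup\left\{ \frac{\langle \nu, x-p\rangle_{+}}{\Psi(\nu)} \;:\; p \in \mathcal{X},\ \nu \in \mathcal{X}^{\ast} \text{ such that } \langle \nu, a\rangle \leq \langle \nu, p\rangle \text{ for all } a \in A \right\},$$ with the convention $0/0 = 0$. For $p \in \mathcal{X}$ and $\nu \in \mathcal{X}^{\ast}$ let $\mathbb{H}_{p,\nu} := \{x \in \mathcal{X} : \langle \nu, x-p\rangle \leq 0\}$. Let $X$ be a random variable taking values in $\mathcal{X}$ that has an expectation $\mathbb{E}[X] \in \mathcal{X}$. Then the following statements about $X$ are equivalent: (i) for every $p \in \mathcal{X}$ and $\nu \in \mathcal{X}^{\ast}$, $$\mathbb{P}[X \in \mathbb{H}_{p,\nu}] \leq \exp\left(-\frac{d_{\perp,\Psi}(\mathbb{E}[X],\mathbb{H}_{p,\nu})^{2}}{2}\right);$$ (ii) for every (measurable) convex set $K \subseteq \mathcal{X}$, $$\mathbb{P}[X \in K] \leq \exp\left(-\frac{d_{\perp,\Psi}(\mathbb{E}[X],K)^{2}}{2}\right);$$ (iii) for every measurable $A \subseteq \mathcal{X}$, $$\mathbb{P}[X \in A] \leq \exp\left(-\frac{d_{\perp,\Psi}(\mathbb{E}[X],A)^{2}}{2}\right);$$ (iv)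 for every measurable $f \colon \mathcal{X} \to \mathbb{R}\cup\{\pm\infty\}$ and every $\theta \in \mathbb{R}\cup\{\pm\infty\}$, $$\mathbb{P}[f(X) \leq \theta] \leq \exp\left(-\frac{d_{\perp,\Psi}(\mathbb{E}[X], f^{-1}([-\infty,\theta]))^{2}}{2}\right);$$ (v) for every (measurable) quasiconvex $f \colon \mathcal{X} \to \mathbb{R}\cup\{\pm\infty\}$ and every $\theta \in \mathbb{R}\cup\{\pm\infty\}$, $$\mathbb{P}[f(X) \leq \theta] \leq \exp\left(-\frac{d_{\perp,\Psi}(\mathbb{E}[X], f^{-1}([-\infty,\theta]))^{2}}{2}\right).$$
   Context: $\langle \nu, x\rangle$ denotes the dual pairing of $\nu \in \mathcal{X}^{\ast}$ and $x \in \mathcal{X}$, and $t_{+} := \max\{t,0\}$. $\Psi$ is positively homogeneous of degree one if $\Psi(\alpha \ell) = \alpha\Psi(\ell)$ for all $\alpha \geq 0$ and $\ell \in \mathcal{X}^{\ast}$ (with $0\cdot\infty = 0$, so $\Psi(0)=0$). Extended-real conventions: $0/0 = 0$, $c/0 = +\infty$ for $c>0$, $c/(+\infty) = 0$ for $0 \le c < \infty$, $\exp(-\infty)=0$. $X$ is a random variable on a probability space $(\Omega,\mathscr{F},\mathbb{P})$ with values in $\mathcal{X}$; $\mathcal{X}$ carries its Borel $\sigma$-algebra. $\mathbb{E}[X]$ denotes any $m \in \mathcal{X}$ such that, for every $\ell \in \mathcal{X}^{\ast}$, $\langle \ell, X-m\rangle$ is integrable with $\mathbb{E}[\langle \ell,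 X - m\rangle] = 0$ (the quantities $d_{\perp,\Psi}(\mathbb{E}[X],\cdot)$ do not depend on the choice of $m$). A function $f \colon \mathcal{X} \to \mathbb{R}\cup\{\pm\infty\}$ is quasiconvex if for every $\theta \in \mathbb{R}\cup\{\pm\infty\}$ the sublevel set $f^{-1}([-\infty,\theta]) = \{x : -\infty \leq f(x) \leq \theta\}$ is convex. *)

(* Defs.v *)
From HB Require Import structures.
From mathcomp Require Import all_boot all_order all_algebra.
From mathcomp Require Import all_classical all_reals all_analysis.
From mathcomp Require Import measurable_realfun.

Set Implicit Arguments.
Unset Strict Implicit.
Unset Printing Implicit Defensive.

Import Order.TTheory GRing.Theory Num.Theory.
Import numFieldNormedType.Exports.

Local Open Scope classical_set_scope.
Local Open Scope ring_scope.

#[short(type="dualType")]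
HB.structure Definition ContinuousLinearForm
    (R : realType) (V : topologicalLmodType R) :=
  {nu of @GRing.Linear R V R^o *:%R nu & @isContinuous V R^o nu}.

Section dual_scale.
Context (R : realType) (V : topologicalLmodType R).

Lemma dual_scale_continuous (a : R) (nu : dualType V) :
  continuous (a \*: nu : V -> R^o).
Proof. by move=> x; apply: (@cvgZl_tmp R R^o); exact: cts_fun. Qed.

HB.instance Definition _ (a : R) (nu : dualType V) :=
  @isContinuous.Build V R^o (a \*: nu) (@dual_scale_continuous a nu).

End dual_scale.

(* A topologicalLmodType carries no pointedType structure, which
   g_sigma_algebraType needs in order to be a measurableType. *)
Definition borelType (R : realType) (V : topologicalLmodType R) : Type :=
  g_sigma_algebraType (@open V).

Section borel_measurable.
Context (R : realType) (V : topologicalLmodType R).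

HB.instance Definition _ := Choice.copy (borelType V) V.
HB.instance Definition _ := isPointed.Build (borelType V) (0 : V).

HB.instance Definition _ := @isMeasurable.Build (sigma_display (@open V))
  (borelType V) <<s (@open V) >>
  (@sigma_algebra0 _ setT (@open V))
  (@sigma_algebraC (borelType V) (@open V))
  (@sigma_algebra_bigcup _ setT (@open V)).

End borel_measurable.

Section definitions.
Context (R : realType) (V : topologicalLmodType R).
Implicit Types (Psi : dualType V -> \bar R) (x p m : V) (nu : dualType V).
Implicit Types (A : set V) (f : V -> \bar R) (theta : \bar R).

Definition positively_homogeneous Psi : Prop :=
  forall (a : R) nu, 0 <= a -> Psi (a \*: nu) = (a%:E * Psi nu)%E.

(* In \bar R, 0^-1 = +oo, +oo^-1 = 0 and 0 * +oo = 0, so the quotient of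
   nonnegative numbers obeys 0 / 0 = 0, c / 0 = +oo for 0 < c, and
   c / +oo = 0 for c finite. *)
Definition dperp Psi x A : \bar R :=
  ereal_sup [set r | exists p nu, (forall a, A a -> nu a <= nu p) /\
    r = ((Num.max (nu (x - p)) 0)%:E / Psi nu)%E].

Definition halfspace p nu : set V := [set x | nu (x - p) <= 0].

Definition sublevel f theta : set V :=
  [set x | (-oo <= f x)%E && (f x <= theta)%E].

Definition quasiconvex f : Prop :=
  forall theta, convex_set (sublevel f theta).

Definition is_expectation d (Omega : measurableType d)
    (P : probability Omega R) (X : Omega -> V) m : Prop :=
  forall nu, P.-integrable setT (fun w => (nu (X w - m))%:E) /\
    ('E_P[fun w => nu (X w - m)%R] = 0)%E.

End definitions.

(* Main.v *)
(* If nu a <= nu p for all a in A, then A is contained in the halfspace H_{p,nu},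
   and (p, nu) is admissible for H_{p,nu} too, so <nu, m - p>_+ / Psi nu is at
   most dperp m H_{p,nu}; hence P(X in A) <= P(X in H_{p,nu})
   <= exp (- (<nu, m - p>_+ / Psi nu)^2 / 2), and the supremum over (p, nu)
   yields the bound for arbitrary A. *)
From HB Require Import structures.
Require Import Defs.
From mathcomp Require Import all_boot all_order all_algebra.
From mathcomp Require Import all_classical all_reals all_analysis.
From mathcomp Require Import unstable measurable_realfun.

Import Order.TTheory GRing.Theory Num.Theory.
Import numFieldNormedType.Exports.

Local Open Scope classical_set_scope.
Local Open Scope ereal_scope.

(** The zero functional is admissible in [dperp] for every set, so the supremum defining [dperp] is
    never taken over an empty set. *)
Lemma exists_dual0 (R : realType) (V : topologicalLmodType R) :
  exists nu : dualType V, forall x, nu x = 0%R.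
Proof.
pose f (_ : V) : R^o := 0%R.
have f_linear : linear f by move=> a x y; rewrite /f scaler0 addr0.
have f_continuous : continuous f by move=> x; exact: cvg_cst.
pose nu : dualType V := HB.pack f
  (GRing.isLinear.Build R V R^o *:%R%R f f_linear)
  (isContinuous.Build V R^o f f_continuous).
by exists nu.
Qed.

(** Inverts the decreasing map r -> exp (- r^2 / 2) on [0, +oo]. In the form of an upper bound on
    [r], the estimate passes to suprema. The condition [c <= 1] makes [- ln c *+ 2] nonnegative, so
    its square root is a genuine one. *)
Lemma expeR_sqr_ge (R : realType) (c : R) (r : \bar R) :
  (0 < c <= 1)%R -> 0 <= r ->
  (c%:E <= expeR (- (r ^+ 2 / 2%:E))) = (r <= (Num.sqrt (- ln c *+ 2))%:E).
Proof.
(* At [r = +oo] both sides are false: the exponential is 0, below [c], and the square root is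
   finite. *)
move=> /andP[c0 c1]; case: r => [r|_|//]; last first.
  have -> : (+oo : \bar R) ^+ 2 / 2%:E = +oo.
    by rewrite /expe /= mulyy inver pnatr_eq0/= gt0_mulye// lte_fin invr_gt0.
  by rewrite /= lee_fin leNgt c0 leye_eq.
rewrite lee_fin => r0.
rewrite -EFin_expe inver pnatr_eq0 /= !lee_fin.
rewrite -ler_ln ?posrE ?expR_gt0// expRK lerNr ler_pdivrMr// mulr_natr.
rewrite -[in RHS](ger0_norm r0) -sqrtr_sqr.
by rewrite ler_sqrt// mulrn_wge0// oppr_ge0 ln_le0.
Qed.

(* S must be nonempty: sup of the empty set is -oo, whose square is +oo. *)
Lemma expeR_sqr_sup_ge (R : realType) (c : \bar R) (S : set (\bar R)) :
  0 <= c <= 1 -> S !=set0 -> (forall r, S r -> 0 <= r) ->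
  (forall r, S r -> c <= expeR (- (r ^+ 2 / 2%:E))) ->
  c <= expeR (- (ereal_sup S ^+ 2 / 2%:E)).
Proof.
move=> /andP[c0 c1] [s Ss] S0 Sc.
have sup0 : 0 <= ereal_sup S := le_trans (S0 s Ss) (ereal_sup_ubound Ss).
case: c c0 c1 Sc => // c; rewrite !lee_fin => c0 c1 Sc.
(* The logarithmic threshold needs [0 < c]; for [c = 0] the bound is trivial. *)
have [c_gt0|] := ltP 0%R c; last first.
  by move=> cle0; apply: le_trans (expeR_ge0 _); rewrite lee_fin.
have c01 : (0 < c <= 1)%R by rewrite c_gt0.
rewrite expeR_sqr_ge//; apply: ge_ereal_sup => r Sr.
by rewrite -expeR_sqr_ge ?S0 ?Sc.
Qed.

Section halfspaces.
Context (R : realType) (V : topologicalLmodType R).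
Implicit Types (p x : V) (nu : dualType V) (A : set V).

(** Open rays generate the Borel sets of the line, and continuity pulls them back to open sets. *)
Lemma measurable_dual nu :
  measurable_fun [set: borelType V] (fun x => (nu x)%:E).
Proof.
apply/measurable_EFinP => mT; apply: (measurability _ (RGenOInfty.measurableE R)) => //.
move=> _ [_ [x ->] <-]; rewrite setTI.
apply: sub_sigma_algebra; apply: (@open_comp V R^o); last exact: interval_open.
by move=> y _; exact: cts_fun.
Qed.

Lemma halfspaceE p nu x : halfspace p nu x = (nu x <= nu p)%R.
Proof. by rewrite /halfspace /= raddfB subr_le0. Qed.

Lemma measurable_halfspace p nu :
  measurable (halfspace p nu : set (borelType V)).
Proof.
rewrite (_ : halfspace p nu =
    [set: borelType V] `&` [set x | (nu x)%:E <= (nu p)%:E]); last first.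
  by rewrite setTI; apply/funext => x; rewrite halfspaceE.
by apply: emeasurable_fun_infty_c => //; exact: measurable_dual.
Qed.

Lemma convex_halfspace p nu : convex_set (halfspace p nu).
Proof.
move=> x y t; rewrite !inE => xH yH.
rewrite halfspaceE in xH; rewrite halfspaceE in yH.
rewrite halfspaceE raddfD /= !linearZ /= -[leRHS]mul1r.
rewrite -[X in (X * _)%R](add_onemK t%:num%R) mulrDl.
by rewrite lerD// ler_wpM2l// onem_ge0// le1.
Qed.
End halfspaces.

Section deviation.
Context (R : realType) (V : topologicalLmodType R).
Implicit Types (p x m : V) (nu : dualType V) (A : set V).

Lemma sublevelE (f : V -> \bar R) (theta : \bar R) :
  sublevel f theta = [set x | f x <= theta].
Proof. by apply/funext => x; rewrite /sublevel /= leNye. Qed.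

Lemma quasiconvex_dual nu : quasiconvex (fun x => (nu x)%:E).
Proof.
move=> theta; rewrite sublevelE => x y t; rewrite !inE /= => xt yt.
(* The endpoint with the larger value bounds a halfspace containing both endpoints, hence the
   segment; this treats finite and infinite [theta] alike. *)
have [xy|/ltW yx] := leP (nu x) (nu y).
  have := @convex_halfspace R V y nu x y t.
  rewrite !inE !halfspaceE => /(_ xy (lexx _)).
  by rewrite -lee_fin => /le_trans; apply.
have := @convex_halfspace R V x nu x y t.
rewrite !inE !halfspaceE => /(_ (lexx _) yx).
by rewrite -lee_fin => /le_trans; apply.
Qed.

Context (d : measure_display) (Omega : measurableType d).
Context (P : probability Omega R) (X : {RV P >-> borelType V}).

Lemma prob_le_dperp (Psi : dualType V -> \bar R) m A :
  (forall nu, 0 <= Psi nu) -> measurable (A : set (borelType V)) ->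
  (forall p nu, P (X @^-1` halfspace p nu)
    <= expeR (- (dperp Psi m (halfspace p nu) ^+ 2 / 2%:E))) ->
  P (X @^-1` A) <= expeR (- (dperp Psi m A ^+ 2 / 2%:E)).
Proof.
move=> Psi_ge0 mA PH.
have mX B : measurable (B : set (borelType V)) -> measurable (X @^-1` B).
  by move=> mB; exact: measurable_funPTI.
have ratio_ge0 p nu : 0 <= (Num.max (nu (m - p)%R) 0%R)%:E / Psi nu.
  by rewrite mule_ge0 ?inve_ge0// lee_fin le_max lexx orbT.
apply: expeR_sqr_sup_ge.
- by rewrite measure_ge0 probability_le1//; exact: mX.
- have [nu nu0] := exists_dual0 R V.
  exists ((Num.max (nu (m - 0)%R) 0%R)%:E / Psi nu), 0%R, nu.
  by split=> // a _; rewrite !nu0.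
- by move=> _ [p [nu [_ ->]]]; exact: ratio_ge0.
move=> _ [p [nu [Anu ->]]].
apply: (@le_trans _ _ (P (X @^-1` halfspace p nu))).
  apply: le_measure; rewrite ?inE; [exact: mX|apply: mX; exact: measurable_halfspace|].
  by move=> w /Anu; rewrite /preimage /= halfspaceE.
(* It remains to compare squares: the ratio is one of the terms of the supremum for its own
   halfspace. *)
apply: (le_trans (PH p nu)); rewrite lee_expeR leeN2.
rewrite lee_wpmul2r ?inve_ge0 ?lee_fin//.
set r := _ / _; have r0 : 0 <= r := ratio_ge0 p nu.
have rd : r <= dperp Psi m (halfspace p nu).
  apply: ereal_sup_ubound; exists p, nu; split=> // a.
  by rewrite halfspaceE.
by rewrite /expe /= lee_pmul.
Qed.

End deviation.

Theorem theorem1p1 (R : realType) (V : topologicalLmodType R)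
    (Psi : dualType V -> \bar R)
    (Psi_ge0 : forall nu, 0 <= Psi nu)
    (Psi_hom : positively_homogeneous Psi)
    (d : measure_display) (Omega : measurableType d) (P : probability Omega R)
    (X : {RV P >-> borelType V})
    (m : V) (Xm : is_expectation P X m) :
  [<->
    (forall (p : V) (nu : dualType V),
      P (X @^-1` halfspace p nu)
        <= expeR (- (dperp Psi m (halfspace p nu) ^+ 2 / 2%:E)));
    (forall K : set V,
      measurable (K : set (borelType V)) -> convex_set K ->
      P (X @^-1` K) <= expeR (- (dperp Psi m K ^+ 2 / 2%:E)));
    (forall A : set V,
      measurable (A : set (borelType V)) ->
      P (X @^-1` A) <= expeR (- (dperp Psi m A ^+ 2 / 2%:E)));
    (forall (f : V -> \bar R) (theta : \bar R),
      measurable_fun [set: borelType V] f ->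
      P [set w | f (X w) <= theta]
        <= expeR (- (dperp Psi m (sublevel f theta) ^+ 2 / 2%:E)));
    (forall (f : V -> \bar R) (theta : \bar R),
      measurable_fun [set: borelType V] f -> quasiconvex f ->
      P [set w | f (X w) <= theta]
        <= expeR (- (dperp Psi m (sublevel f theta) ^+ 2 / 2%:E)))].
Proof.
split.
  by move=> PH K mK _; exact: prob_le_dperp.
split.
  (* Halfspaces are themselves measurable convex sets, so the bound for convex sets covers them. *)
  move=> PK A mA; apply: prob_le_dperp => // p nu.
  by apply: PK; [exact: measurable_halfspace|exact: convex_halfspace].
split.
  move=> PA f theta mf; rewrite sublevelE; apply: (PA [set x | f x <= theta]).
  by rewrite -[X in measurable X]setTI; exact: emeasurable_fun_infty_c.
split.
  by move=> Pf f theta mf _; exact: Pf.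
move=> Pf p nu.
(* The cycle closes by viewing a halfspace as a sublevel set of the quasiconvex function [nu]. *)
have -> : halfspace p nu = sublevel (fun x => (nu x)%:E) (nu p)%:E.
  by rewrite sublevelE; apply/funext => x; rewrite halfspaceE.
rewrite [X in P (_ @^-1` X)]sublevelE.
apply: Pf; last exact: quasiconvex_dual.
exact: measurable_dual.
Qed.
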